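(* $\cong_{\mathsf{LO}}\ \le_B\ \underline{\bowtie}^{<\omega}_{\mathsf{CO}}$.
   Context: $\mathsf{LO}$ is the Polish space of codes for reflexive linear orders on $\mathbb{N}$ and $\cong_{\mathsf{LO}}$ is isomorphism. A circular order on $X$ is a ternary relation $C$ satisfying: cyclicity ($C(x,y,z)\Rightarrow C(y,z,x)$), antisymmetry/reflexivity ($C(x,y,z)\wedge C(y,x,z)\iff x=y\vee y=z\vee z=x$), transitivity ($C(x,y,z)\Rightarrow\forall t\,(C(x,y,t)\vee C(t,y,z))$), totality ($C(x,y,z)\vee C(y,x,z)$). Embeddings are injections preserving $C$. $A$ is convex in $C$ if for distinct $x,y\in A$, either all $c$ with $C(x,c,y)$ or all $c$ with $C(y,c,x)$ lie in $A$. A finite convex partition $\{C_i:i<n\}$ of $C$ is a partition into convex sets such that $C(x,y,z)$, $x\in C_i,y\in C_j,z\in C_k$ imply that $(i,j,k)$ is cyclically ordered in $\{0,\dots,n-1\}$ (i.e. $i\le j\le k$ or $j\le k\le i$ or $k\le i\le j$). $C\trianglelefteq^{<\omega}_c C'$ iff there are a finite convex partition $\{C_i\}$ of $C$ and an embedding $f\colon C\to C'$ with each $f(C_i)$ convex in $C'$. $\mathsf{CO}$ is the Polish space of codes for circular orders on $\mathbb{N}$, and $C\mathrel{\underline{\bowtie}^{<\omega}_{\mathsf{CO}}}C'$ iff $C\trianglelefteq^{<\omega}_c C'$ and $C'\trianglelefteq^{<\omega}_c C$. $\le_B$ is Borel reducibility. *)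

(* Defs.v *)
From HB Require Import structures.
From mathcomp Require Import all_boot all_order all_algebra.
From mathcomp Require Import all_classical all_reals all_analysis.

Set Implicit Arguments.
Unset Strict Implicit.
Unset Printing Implicit Defensive.

Local Open Scope classical_set_scope.

(** [<<s open >>] is the Borel sigma-algebra; it is used
    directly rather than through [measurable_fun] because the latter needs a
    pointed carrier. *)

Definition borel_function (X Y : topologicalType) (f : X -> Y) : Prop :=
  forall B : set Y, <<s @open Y >> B -> <<s @open X >> (f @^-1` B).

Definition borel_reducible (X Y : topologicalType)
    (E : X -> X -> Prop) (F : Y -> Y -> Prop) : Prop :=
  exists2 f : X -> Y, borel_function f &
    forall x y : X, E x y <-> F (f x) (f y).

(** The set [LO], used as a type, is coerced to [set_type LO], which carries
    the subspace topology inherited from the Polish space [2^(nat * nat)];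
    likewise for [CO] below. *)

Definition linear_order (T : Type) (r : rel T) : Prop :=
  [/\ reflexive r, antisymmetric r, transitive r & total r].

Definition LO : set (prod_topology (fun _ : nat * nat => bool)) :=
  [set c | linear_order (fun x y => c (x, y))].

Definition LO_rel (L : LO) : rel nat := fun x y => (\val L) (x, y).

Definition iso_LO (L L' : LO) : Prop :=
  exists2 f : nat -> nat, bijective f &
    forall x y, LO_rel L x y = LO_rel L' (f x) (f y).

Section CircularOrders.
Context {T : Type}.
Implicit Types (C : T -> T -> T -> bool) (A : set T).

Definition circular_order C : Prop :=
  [/\ forall x y z, C x y z -> C y z x,
      forall x y z, (C x y z /\ C y x z) <-> [\/ x = y, y = z | z = x],
      forall x y z, C x y z -> forall t, C x y t \/ C t y z
    & forall x y z, C x y z \/ C y x z].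

Definition convex_in C A : Prop :=
  forall x y, A x -> A y -> x <> y ->
    [set c | C x c y] `<=` A \/ [set c | C y c x] `<=` A.

Definition cyclically_ordered (i j k : nat) : bool :=
  [|| i <= j <= k, j <= k <= i | k <= i <= j].

Definition finite_convex_partition C n (P : 'I_n -> set T) : Prop :=
  [/\ partition setT P setT,
      forall i, convex_in C (P i)
    & forall x y z (i j k : 'I_n), C x y z -> P i x -> P j y -> P k z ->
        cyclically_ordered i j k].

End CircularOrders.

(** Since circular orders are total and antisymmetric, such an [f] also
    reflects the order. *)
Definition co_embedding (T U : Type) (C : T -> T -> T -> bool)
    (C' : U -> U -> U -> bool) (f : T -> U) : Prop :=
  injective f /\ forall x y z, C x y z -> C' (f x) (f y) (f z).

Definition piecewise_convex_embeddable (T U : Type) (C : T -> T -> T -> bool)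
    (C' : U -> U -> U -> bool) : Prop :=
  exists (n : nat) (P : 'I_n -> set T) (f : T -> U),
    [/\ finite_convex_partition C P, co_embedding C C' f
      & forall i, convex_in C' (f @` P i)].

Definition CO : set (prod_topology (fun _ : nat * nat * nat => bool)) :=
  [set c | circular_order (fun x y z => c (x, y, z))].

Definition CO_rel (C : CO) : nat -> nat -> nat -> bool :=
  fun x y z => (\val C) (x, y, z).

Definition bowtie_CO (C C' : CO) : Prop :=
  piecewise_convex_embeddable (CO_rel C) (CO_rel C') /\
  piecewise_convex_embeddable (CO_rel C') (CO_rel C).

(* Main.v *)
Require Import Defs.
From mathcomp Require Import all_boot all_order all_algebra.
From mathcomp Require Import all_classical all_reals all_analysis.
From mathcomp Require Import zify.

Set Implicit Arguments.
Unset Strict Implicit.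
Unset Printing Implicit Defensive.

Import Order.TTheory GRing.Theory Num.Theory.
Local Open Scope classical_set_scope.

(** Replace every point of [L] by a copy of the integers, put a separator in
    front, and close up the sum of infinitely many copies of [1 + int * L] into
    a circle. Every integer point has an immediate successor and an immediate
    predecessor, while separators have neither. A finite convex partition leaves
    two consecutive copies in one piece, and the embedding maps at least one of
    them, with its two bounding separators, onto an arc. Immediate successors
    are then preserved, so this copy is carried onto a whole copy of
    [int * L'], and chains of successors onto chains of successors: this is an
    isomorphism from [L] to [L']. The coding of [L] is continuous because each
    of its values depends on finitely many values of [L]. *)

(** * Linear orders and their closure into a circle *)

Definition lexicographic (I : eqType) (J : Type) (r : rel I) (s : rel J) :
    rel (I * J) :=
  fun p q => if p.1 == q.1 then s p.2 q.2 else r p.1 q.1.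

Definition with_bottom (J : Type) (s : rel J) : rel (option J) :=
  fun u v => if u is Some x then if v is Some y then s x y else false else true.

(** The usual circle obtained by joining the two ends of a linear order: some rotation of the triple
    is weakly increasing. *)
Definition cyclic_closure (T : Type) (r : rel T) : T -> T -> T -> bool :=
  fun x y z => [|| r x y && r y z, r y z && r z x | r z x && r x y].

Lemma lexicographic_linear (I : eqType) (J : Type) (r : rel I) (s : rel J) :
  linear_order r -> linear_order s -> linear_order (lexicographic r s).
Proof.
move=> [rr ra rt rT] [sr sa st sT]; rewrite /lexicographic; split.
- by move=> [i x] /=; rewrite eqxx.
- move=> [i x] [j y] /=; rewrite (eq_sym j i).
  by case: eqP => [-> /sa -> //|ij /ra /ij].
- move=> [j y] [i x] [k z] /=.
  case: (eqVneq i j) => [<-|ij]; case: eqVneq => //.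
  + by move=> _; exact: st.
  + by move=> <- rij _; rewrite (negbTE ij).
  + move=> jk rij rjk; case: eqVneq => [ik|_]; last exact: rt rij rjk.
    by move: ij; rewrite (ra i j) ?eqxx // rij ik rjk.
- move=> [i x] [j y] /=; rewrite (eq_sym j i).
  by case: eqP => _; [exact: sT|exact: rT].
Qed.

Lemma with_bottom_linear (J : Type) (s : rel J) :
  linear_order s -> linear_order (with_bottom s).
Proof.
move=> [sr sa st sT]; split.
- by case.
- by move=> [x|] [y|] //= /sa ->.
- by move=> [y|] [x|] [z|] //=; exact: st.
- by move=> [x|] [y|] //=; exact: sT.
Qed.

Lemma leq_linear : linear_order leq.
Proof.
split; [exact: leqnn|exact: anti_leq|exact: leq_trans|exact: leq_total].
Qed.

Lemma ler_linear (R : realDomainType) :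
  linear_order (fun x y : R => (x <= y)%R).
Proof. split; [exact: lexx|exact: le_anti|exact: le_trans|exact: le_total]. Qed.

Local Ltac pick_case :=
  first [apply: Or31; solve [eauto 4] | apply: Or32; solve [eauto 4]
        |apply: Or33; solve [eauto 4]].

Lemma cyclic_closure_circular (T : Type) (r : rel T) :
  linear_order r -> circular_order (cyclic_closure r).
Proof.
move=> [rr ra rt rT]; rewrite /cyclic_closure.
have tr x y z : r x y -> r y z -> r x z by move=> xy; exact: rt xy.
have an x y : r x y -> r y x -> x = y by move=> xy yx; apply: ra; rewrite xy.
have CP x y z : [\/ r x y /\ r y z, r y z /\ r z x | r z x /\ r x y] ->
    cyclic_closure r x y z.
  by rewrite /cyclic_closure => -[] [-> ->]; rewrite ?orbT.
split.
- by move=> x y z /or3P[] /andP[-> ->]; rewrite ?orbT.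
- move=> x y z; split=> [|xyz].
    by move=> [/or3P[] /andP[a b] /or3P[] /andP[c d]];
      pick_case.
  case: xyz => ->; split; apply: CP;
    case/orP: (rT x y) => ?; case/orP: (rT y z) => ?;
    case/orP: (rT z x) => ?; pick_case.
- move=> x y z + t => /or3P[] /andP[a b];
    case/orP: (rT x t) => ?; case/orP: (rT y t) => ?; case/orP: (rT z t) => ?;
    first [left; apply: CP; pick_case|right; apply: CP; pick_case].
- move=> x y z;
    case/orP: (rT x y) => ?; case/orP: (rT y z) => ?; case/orP: (rT z x) => ?;
    first [left; apply: CP; pick_case|right; apply: CP; pick_case].
Qed.

(** * Arcs and immediate successors in a circular order *)

Section CircularOrder.
Context {T : Type} {C : T -> T -> T -> bool}.
Hypothesis circC : circular_order C.

Lemma circ_rot x y z : C x y z -> C y z x.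
Proof. by case: circC => rot _ _ _; exact: rot. Qed.

Lemma circ_total x y z : C x y z \/ C y x z.
Proof. by case: circC => _ _ _; exact. Qed.

Lemma circ_anti x y z : C x y z -> C y x z -> [\/ x = y, y = z | z = x].
Proof. by case: circC => _ anti _ _ xyz yxz; apply/anti. Qed.

Lemma circ_deg x y z : [\/ x = y, y = z | z = x] -> C x y z.
Proof. by case: circC => _ anti _ _ /anti []. Qed.

Lemma circ_trans x y z t : C x y z -> C x y t \/ C t y z.
Proof. by case: circC => _ _ trans _ xyz; exact: trans. Qed.

(** Read [C x c y] as: [c] lies on the arc from [x] to [y]. If [x = y], this holds for every [c],
    whence the hypothesis [x <> y]. *)
Lemma arc_subl x y z c : C x y z -> x <> y -> C x c y -> C x c z.
Proof.
move=> xyz xNy xcy; have zxy : C z x y by apply/circ_rot/circ_rot.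
have [zxc|cxy] := circ_trans c zxy; first exact: circ_rot.
have [xc|cy|/esym//] := circ_anti xcy cxy; last by rewrite cy.
exact/circ_deg/Or31.
Qed.

Lemma arc_subr x y z c : C x y z -> x <> z -> y <> z -> C y c z -> C x c z.
Proof.
move=> xyz xNz yNz ycz; have yzx : C y z x by exact: circ_rot.
have [yzc|czx] := circ_trans c yzx; last exact/circ_rot/circ_rot.
have zyc : C z y c by apply/circ_rot/circ_rot.
have cyz : C c y z by apply/circ_rot/circ_rot.
have [yc|cz|/esym//] := circ_anti ycz cyz; first by rewrite -yc.
by rewrite cz; apply/circ_deg/Or32.
Qed.

Definition covers p q := p <> q /\ forall c, C p c q -> c = p \/ c = q.

(** Going round from [p], whichever of [q] and [q'] comes first lies on the arc to the other. *)
Lemma covers_unique p q q' : covers p q -> covers p q' -> q = q'.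
Proof.
move=> [pNq pq] [pNq' pq']; have [pqq'|qpq'] := circ_total p q q'.
  by case: (pq' _ pqq') => // qp; case: pNq.
by case: (pq _ (circ_rot qpq')) => // q'p; case: pNq'.
Qed.

Lemma covers_uniquel p p' q : covers p q -> covers p' q -> p = p'.
Proof.
move=> [pNq pq] [pNq' p'q]; have [pp'q|p'pq] := circ_total p p' q.
  by case: (pq _ pp'q).
by case: (p'q _ p'pq).
Qed.

End CircularOrder.

Arguments covers {T} C p q.

(** * Embeddings, arcs and immediate successors *)

Section Embedding.
Context {T U : Type} {C : T -> T -> T -> bool} {C' : U -> U -> U -> bool}.
Hypotheses (circC : circular_order C) (circC' : circular_order C').
Context {f : T -> U}.
Hypothesis embf : co_embedding C C' f.

Lemma co_embeddingE x y z : C' (f x) (f y) (f z) = C x y z.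
Proof.
have [finj fC] := embf; apply/idP/idP => [fxyz|]; last exact: fC.
have [//|/fC fyxz] := circ_total circC x y z.
apply: (circ_deg circC).
by case: (circ_anti circC' fxyz fyxz) => /finj ->;
  [apply: Or31|apply: Or32|apply: Or33].
Qed.

Definition arc_onto x y :=
  forall c, C' (f x) c (f y) -> exists2 d, C x d y & c = f d.

(** If the image of [P] does not contain the arc from [f x] to [f y], it
    contains the complementary arc, hence the one from [f y] to [f z]. *)
Lemma arc_onto_convex P x y z : convex_in C' (f @` P) ->
  P x -> P y -> C x y z -> x <> y -> y <> z -> arc_onto x y \/ arc_onto y z.
Proof.
move=> convf Px Py xyz xNy yNz; have [finj fC] := embf.
have fxNy : f x <> f y by move/finj.
have fyNz : f y <> f z by move/finj.
have [] := convf (f x) (f y) (imageP f Px) (imageP f Py) fxNy => sub.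
  left=> c xcy; have [d _ dc] := sub _ xcy.
  by exists d; rewrite // -co_embeddingE dc.
right=> c ycz; have [|d _ dc] := sub c.
  by apply: (arc_subl circC') fyNz ycz; apply/fC/(circ_rot circC).
by exists d; rewrite // -co_embeddingE dc.
Qed.

(** An embedding may leave new points between two images, but it keeps every point that was already
    between. *)
Lemma covers_reflect p q : covers C' (f p) (f q) -> covers C p q.
Proof.
have [finj fC] := embf; move=> [pNq pq]; split=> [e|c /fC /pq].
  by apply: pNq; rewrite e.
by case=> /finj ->; [left|right].
Qed.

(** A point between [f p] and [f q] is on the arc from [f x] to [f y], so it is the image of some
    [d], and [d] is then between [p] and [q]. *)
Lemma covers_arc x p q y : arc_onto x y -> C x p q -> C x q y -> x <> q ->
  covers C p q -> covers C' (f p) (f q).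
Proof.
have [finj fC] := embf; move=> onto /fC xpq /fC xqy xNq [pNq pq].
split=> [/finj//|c pcq].
have fxNq : f x <> f q by move/finj.
have fpNq : f p <> f q by move/finj.
have [d _ e] := onto c (arc_subl circC' xqy fxNq
  (arc_subr circC' xpq fxNq fpNq pcq)).
by move: pcq; rewrite e co_embeddingE => /pq[] ->; [left|right].
Qed.

End Embedding.

Arguments arc_onto {T U} C C' f x y.

Lemma bijectiveP T U (f : T -> U) :
  injective f -> (forall y, exists x, f x = y) -> bijective f.
Proof.
move=> finj fsurj; rewrite -setTT_bijective; split=> [//|x y _ _ /finj //|y _].
by have [x <-] := fsurj y; exists x.
Qed.

(** * The circle that codes a linear order *)

(** The order on [points] is the sum over [nat] of the copies of [1 + int * L]:
    [(m, None)] is the separator starting copy [m], and [(m, Some (l, k))] is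
    the integer [k] in the copy of the integers that replaces [l]. *)
Definition points := (nat * option (nat * int))%type.

Definition block_order (r : rel nat) : rel (nat * int) :=
  lexicographic r (fun j k : int => (j <= k)%R).

Definition sum_order (r : rel nat) : rel points :=
  lexicographic leq (with_bottom (block_order r)).

Definition coding (r : rel nat) : points -> points -> points -> bool :=
  cyclic_closure (sum_order r).

Section Coding.
Context {r : rel nat}.
Hypothesis linr : linear_order r.

Lemma block_order_linear : linear_order (block_order r).
Proof. exact: lexicographic_linear linr (ler_linear _). Qed.

Lemma coding_circular : circular_order (coding r).
Proof.
apply/cyclic_closure_circular/(lexicographic_linear leq_linear).
exact/with_bottom_linear/block_order_linear.
Qed.

Lemma coding_sep m n p :
  coding r (m, None) (n, None) (p, None) = cyclically_ordered m n p.
Proof.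
rewrite /coding /cyclic_closure /sum_order /lexicographic.
rewrite /cyclically_ordered /=.
have E i j : (if i == j then true else i <= j) = (i <= j).
  by case: eqP => // ->; rewrite leqnn.
by rewrite !E.
Qed.

Lemma coding_arc m p : coding r (m, None) p (m.+1, None) <->
  [\/ p = (m, None), p = (m.+1, None) | exists u, p = (m, Some u)].
Proof.
case: p => n v; rewrite /coding /cyclic_closure /sum_order /lexicographic /=.
rewrite (gtn_eqF (ltnSn m)) ltnn andbF orbF.
split.
  have [<-|mNn] := eqVneq m n.
    by case: v => [u|] _; [apply: Or33; exists u|exact: Or31].
  have [->|nNm] := eqVneq n m.+1; last by move=> mnm; lia.
  by case: v => [u|] /=; [rewrite andbF|move=> _; exact: Or32].
by case=> [[]|[]|[u] []] -> ->;
  rewrite ?eqxx ?leqnn ?leqnSn ?(ltn_eqF (ltnSn m)) ?(gtn_eqF (ltnSn m)).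
Qed.

(** The separator is strictly below its copy, so a comparison back to it fails and only the
    unrotated alternative of the closure survives. *)
Lemma coding_block m u v :
  coding r (m, None) (m, Some u) (m, Some v) = block_order r u v.
Proof.
rewrite /coding /cyclic_closure /sum_order /lexicographic /= eqxx /=.
by rewrite !andbF /= orbF.
Qed.

Lemma covers_succ m l k :
  covers (coding r) (m, Some (l, k)) (m, Some (l, k + 1)%R).
Proof.
have [rr ra rt rT] := linr.
split=> [[]|[n [[l' k']|]]]; first by lia.
  rewrite /coding /cyclic_closure /sum_order /lexicographic /block_order /=.
  rewrite /lexicographic /= !eqxx (eq_sym n m) (eq_sym l' l).
  case: eqVneq => [<-|mn]; last by lia.
  case: eqVneq => [<-|ll'] /=.
    case/or3P=> /andP[a b]; try by lia.
    by have [->|->] : k' = k \/ k' = (k + 1)%R; [lia|left|right].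
  (* A point over another [l'] could only be between if [l'] were both above and below [l]. *)
  have : ~~ (r l l' && r l' l) by apply/negP => /ra; apply/eqP.
  by case: (r l l'); case: (r l' l) => //=; lia.
rewrite /coding /cyclic_closure /sum_order /lexicographic /block_order /=.
rewrite /lexicographic /= !eqxx (eq_sym n m).
by case: eqVneq => [<-|mn]; lia.
Qed.

(** The integers have no least element: within copy [m] the previous integer point is still in
    between, and for [p] in another copy any integer point of copy [m] is. *)
Lemma sep_covers m p : ~ covers (coding r) (m, None) p.
Proof.
move=> [mNp mp]; case: p => n v in mNp mp.
have [c [cm cp mcp]] : exists c, [/\ c <> (m, None), c <> (n, v)
    & coding r (m, None) c (n, v)].
  have [mn|mNn] := eqVneq m n; last first.
    exists (m, Some (0, 0%R)); split=> [//|[/eqP]|].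
      by rewrite (negbTE mNn).
    rewrite /coding /cyclic_closure /sum_order /lexicographic /=.
    by rewrite eqxx (negbTE mNn) eq_sym (negbTE mNn) /=; lia.
  case: v mNp {mp} => [[l k] _|]; last by rewrite mn.
  exists (n, Some (l, k - 1)%R); split=> [//|[]|]; first by lia.
  rewrite mn coding_block /block_order /lexicographic /= eqxx; lia.
by case: (mp _ mcp).
Qed.

(** An integer point already has an integer point as its only successor, and a separator has no
    successor. *)
Lemma covers_sep m p : ~ covers (coding r) p (m, None).
Proof.
case: p => n [[l k]|]; last exact: sep_covers.
by move/(covers_unique coding_circular)/(_ (covers_succ n l k)).
Qed.

Lemma covers_pred m l k :
  covers (coding r) (m, Some (l, k - 1)%R) (m, Some (l, k)).
Proof. by rewrite -{2}(subrK 1%R k); exact: covers_succ. Qed.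

End Coding.

(** * Recovery of the linear order from an embedding *)

Section Recovery.
Context {r r' : rel nat}.
Hypotheses (linr : linear_order r) (linr' : linear_order r').
Context {f : points -> points}.
Hypothesis embf : co_embedding (coding r) (coding r') f.

Let circ := coding_circular linr.
Let circ' := coding_circular linr'.

(** Pigeonhole: among [n + 1] separators two share a piece, which by convexity contains one of the
    two arcs joining them. Even indices leave room for two whole copies between them. *)
Lemma consecutive_seps n (P : 'I_n -> set points) :
    finite_convex_partition (coding r) P ->
  exists i m, [/\ P i (m, None), P i (m.+1, None) & P i (m.+2, None)].
Proof.
move=> [[Pcover _ _] Pconv _].
have /choice[piece pieceP] p : exists i, P i p.
  have [i _ Pip] : cover setT P p; first by rewrite Pcover.
  by exists i.
have /injectivePn[a [b aNb]] :
    ~~ injectiveb (fun k : 'I_n.+1 => piece ((k : nat).*2, None)).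
  by apply/negP => /injectiveP /leq_card; rewrite !card_ord ltnn.
wlog ab : a b aNb / (a < b)%N => [th|e].
  have := aNb; rewrite neq_ltn => /orP[ab|ba] e; first exact: th ab e.
  by apply: th ba _; rewrite // eq_sym.
have Pa := pieceP ((a : nat).*2, None).
have Pb := pieceP ((b : nat).*2, None); rewrite -e in Pb.
exists (piece ((a : nat).*2, None)).
have [|sub|sub] := Pconv _ _ _ Pa Pb.
- by case; lia.
- exists (a : nat).*2; split; first exact: Pa.
    by apply: sub; rewrite /= coding_sep /cyclically_ordered; lia.
  by apply: sub; rewrite /= coding_sep /cyclically_ordered; lia.
(* The arc from [b] round to [a] passes through all later separators. *)
- exists (b : nat).*2; split; first exact: Pb.
    by apply: sub; rewrite /= coding_sep /cyclically_ordered; lia.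
  by apply: sub; rewrite /= coding_sep /cyclically_ordered; lia.
Qed.

Section Block.
Context {m : nat}.
Let x : points := (m, None).
Let y : points := (m.+1, None).
Hypothesis onto : arc_onto (coding r) (coding r') f x y.

Let xNy : x <> y.
Proof. by case; lia. Qed.

Lemma arc_block u : coding r x (m, Some u) y.
Proof. by apply/coding_arc/Or33; exists u. Qed.

Lemma f_succ l k :
  covers (coding r') (f (m, Some (l, k))) (f (m, Some (l, k + 1)%R)).
Proof.
apply: (covers_arc circ circ' embf onto) (arc_block _) _
  (covers_succ linr _ _ _) => //.
rewrite coding_block // /block_order /lexicographic /= eqxx; lia.
Qed.

Lemma f_block_sep l k a : f (m, Some (l, k)) <> (a, None).
Proof. by move=> e; have := f_succ l k; rewrite e; exact: sep_covers. Qed.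

(** Were [f x] an integer point, its successor would be on the image arc, hence equal to some [f d],
    and [d] would be a successor of the separator [x]. *)
Lemma f_sepl : exists a, f x = (a, None).
Proof.
case e : (f x) => [a [[l k]|]]; last by exists a.
have succ := covers_succ linr' a l k; rewrite -e in succ.
have [d _ de] : exists2 d, coding r x d y & (a, Some (l, k + 1)%R) = f d.
  (* If the successor were beyond [f y], then [f y] would lie between [f x] and it, hence coincide
     with it. *)
  apply: onto; have [//|/(circ_rot circ') xyq] :=
    circ_total circ' (f x) (a, Some (l, k + 1)%R) (f y).
  have [_ /(_ _ xyq) [/embf.1/esym/xNy []|->]] := succ.
  by apply: (circ_deg circ'); apply: Or32.
rewrite de in succ.
by case: (sep_covers (covers_reflect embf succ)).
Qed.

Lemma f_sepr : exists b, f y = (b, None).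
Proof.
case e : (f y) => [b [[l k]|]]; last by exists b.
have pred := covers_pred linr' b l k; rewrite -e in pred.
have [d _ de] : exists2 d, coding r x d y & (b, Some (l, k - 1)%R) = f d.
  apply: onto; have [//|qxy] :=
    circ_total circ' (f x) (b, Some (l, k - 1)%R) (f y).
  have [_ /(_ _ qxy) [->|/embf.1/xNy []]] := pred.
  by apply: (circ_deg circ'); apply: Or31.
rewrite de in pred.
by case: (covers_sep linr (covers_reflect embf pred)).
Qed.

(** Otherwise the separator [a.+1] would be strictly inside the image arc, also when that arc wraps
    around, and would be the image of an integer point. *)
Lemma f_seps : exists a, f x = (a, None) /\ f y = (a.+1, None).
Proof.
have [[a fx] [b fy]] := (f_sepl, f_sepr); exists a; split=> //.
have [<-//|bNa] := eqVneq b a.+1.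
have ab : a <> b by move=> ab; apply/xNy/embf.1; rewrite fx fy ab.
have [d /coding_arc xdy de] : exists2 d, coding r x d y & (a.+1, None) = f d.
  by apply: onto; rewrite fx fy coding_sep /cyclically_ordered; lia.
case: xdy de => [->|->|[[l k] ->]].
- by rewrite -/x fx => -[]; lia.
- by rewrite -/y fy => -[] /eqP; rewrite eq_sym (negbTE bNa).
- by move/esym/f_block_sep.
Qed.

Lemma block_recovery :
  exists2 g : nat -> nat, bijective g & forall j k, r j k = r' (g j) (g k).
Proof.
have [a [fx fy]] := f_seps; have [finj fC] := embf.
have /choice[F FE] u : exists v, f (m, Some u) = (a, Some v).
  have := fC _ _ _ (arc_block u); rewrite fx fy.
  case/coding_arc=> [||[v ->]]; last by exists v.
    by case: u => l k /f_block_sep.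
  by case: u => l k /f_block_sep.
have Finj : injective F.
  move=> u v uv; have [//] : (m, Some u) = (m, Some v).
  by apply: finj; rewrite !FE uv.
have Fsucc l k : F (l, k + 1)%R = ((F (l, k)).1, (F (l, k)).2 + 1)%R.
  have := f_succ l k; rewrite !FE; case: (F (l, k)) => l' k' /=.
  by move/(covers_unique circ')/(_ (covers_succ linr' a l' k')) => -[].
(* Commuting with successors, [F] maps the integers over [l] to those over [g l] by the shift
   [h l]. *)
pose g l := (F (l, 0%R)).1; pose h l := (F (l, 0%R)).2.
have FgE l k : F (l, k) = (g l, (h l + k)%R).
  elim/int_rect: k => [|k IH|k IH].
  - by rewrite addr0 /g /h -surjective_pairing.
  - have -> : (k.+1%:Z = k%:Z + 1)%R by lia.
    by rewrite Fsucc IH /= addrA.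
  - have := Fsucc l (- k.+1%:Z)%R.
    have -> : (- k.+1%:Z + 1 = - k%:Z)%R by lia.
    rewrite IH; case: (F _) => u v [<- e]; congr pair; move: (h l) e => hl; lia.
have ginj : injective g.
  (* Swapping the shifts makes both integer coordinates [h j + h k]. *)
  move=> j k gjk; have /Finj[] // : F (j, h k) = F (k, h j).
  by rewrite !FgE gjk addrC.
exists g.
  apply: bijectiveP => // l'.
  have [d /coding_arc xdy] :
      exists2 d, coding r x d y & (a, Some (l', 0%R)) = f d.
    by apply: onto; rewrite fx fy; apply/coding_arc/Or33; exists (l', 0%R).
  case: xdy => [->|->|[[l k] ->]]; rewrite -/x -/y ?fx ?fy //.
  by rewrite FE FgE => -[->]; exists l.
move=> j k; have [<-|jNk] := eqVneq j k.
  by have [rr _ _ _] := linr; have [rr' _ _ _] := linr'; rewrite rr rr'.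
have := co_embeddingE circ circ' embf x (m, Some (j, 0%R)) (m, Some (k, 0%R)).
rewrite fx !FE !coding_block !FgE /block_order /lexicographic /= (inj_eq ginj).
by rewrite (negbTE jNk).
Qed.

End Block.
End Recovery.

(** Three separators are used because convexity of the image guarantees only that one of the two
    copies they bound goes onto an arc. *)
Lemma coding_recovery (r r' : rel nat) : linear_order r -> linear_order r' ->
    piecewise_convex_embeddable (coding r) (coding r') ->
  exists2 g : nat -> nat, bijective g & forall j k, r j k = r' (g j) (g k).
Proof.
move=> linr linr' [n [P [f [partP embf convf]]]].
have [i [m [P0 P1 P2]]] := consecutive_seps partP.
have [|||onto|onto] := arc_onto_convex (coding_circular linr)
  (coding_circular linr') embf (convf i) P0 P1 (z := (m.+2, None)).
- by rewrite coding_sep /cyclically_ordered; lia.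
- by case; lia.
- by case; lia.
- exact: (block_recovery linr linr' embf onto).
- exact: (block_recovery linr linr' embf onto).
Qed.

(** * Isomorphisms and change of carrier *)

Lemma coding_iso (r r' : rel nat) (g : nat -> nat) :
    injective g -> (forall j k, r j k = r' (g j) (g k)) ->
  let f (p : points) : points := (p.1, omap (fun u => (g u.1, u.2)) p.2) in
  forall x y z, coding r x y z = coding r' (f x) (f y) (f z).
Proof.
move=> ginj gE f.
have fE p q : sum_order r p q = sum_order r' (f p) (f q).
  case: p q => m [[j k]|] [n [[j' k']|]] //=.
  by rewrite /sum_order /block_order /lexicographic /= (inj_eq ginj) -gE.
by move=> x y z; rewrite /coding /cyclic_closure !fE.
Qed.

(** One piece suffices; the point of [T] makes it nonempty, as [partition] demands. *)
Lemma iso_piecewise_convex_embeddable (T U : Type) (C : T -> T -> T -> bool)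
    (C' : U -> U -> U -> bool) (f : T -> U) : T -> bijective f ->
    (forall x y z, C x y z = C' (f x) (f y) (f z)) ->
  piecewise_convex_embeddable C C'.
Proof.
move=> x0 bijf fE; have [f' fK f'K] := bijf.
exists 1%N, (fun=> setT), f; split.
- split=> [|i x y _ _ _|x y z i j k _ _ _ _]; last by rewrite !ord1.
    split=> [|i j _ _ _|i _]; last by exists x0.
      by apply/seteqP; split=> // x _; exists ord0.
    by rewrite !ord1.
  by left.
- by split; [exact: bij_inj|move=> x y z; rewrite fE].
- by move=> i x y _ _ _; left=> c _; exists (f' c).
Qed.

(** Conjugating by [e] takes embeddings between codes on [nat] back to [points]. *)
Lemma piecewise_convex_embeddable_transport (T U : Type) (e : U -> T)
    (C C' : T -> T -> T -> bool) : bijective e ->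
    piecewise_convex_embeddable (fun x y z => C (e x) (e y) (e z))
      (fun x y z => C' (e x) (e y) (e z)) ->
  piecewise_convex_embeddable C C'.
Proof.
case=> d eK dK [n [P [f [[[Pcover Ptriv Pne] Pconv Pcyc] [finj fC] convf]]]].
exists n, (fun i => d @^-1` P i), (e \o f \o d); split.
- split.
  + split.
    * apply/seteqP; split=> // t _.
      have [i _ Pi] : cover setT P (d t); first by rewrite Pcover.
      by exists i.
    * by move=> i j _ _ [t [Pi Pj]]; apply: Ptriv => //; exists (d t).
    * by move=> i _; have [u Pu] := Pne i I; exists (e u); rewrite /= eK.
  + move=> i x y Px Py xNy; have [|sub|sub] := Pconv i _ _ Px Py.
    * by move/(can_inj dK).
    * by left=> c xcy; apply: sub; rewrite /= !dK.
    * by right=> c ycx; apply: sub; rewrite /= !dK.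
  + by move=> x y z i j k xyz; apply: Pcyc; rewrite !dK.
- split=> [x y /(can_inj eK) /finj /(can_inj dK)//|x y z xyz].
  by apply: fC; rewrite !dK.
- have imE i t : (f @` P i) (d t) <-> ((e \o f \o d) @` (d @^-1` P i)) t.
    split=> [[u Pu fu]|[s Ps <-]].
      by exists (e u); rewrite /= eK ?fu ?dK.
    by exists (d s); rewrite //= eK.
  move=> i x y /imE Px /imE Py xNy; have [|sub|sub] := convf i _ _ Px Py.
  + by move/(can_inj dK).
  + by left=> c xcy; apply/imE/sub; rewrite /= !dK.
  + by right=> c ycx; apply/imE/sub; rewrite /= !dK.
Qed.

(** * Borel functions and the enumeration of the points *)

(** The sets with Borel preimage form a sigma-algebra containing the open sets. *)
Lemma continuous_borel (X Y : topologicalType) (f : X -> Y) :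
  continuous f -> borel_function f.
Proof.
move=> /continuousP fcont B.
have salg := @sigma_algebra_image _ _ setT f _
  (smallest_sigma_algebra setT (@open X)).
have sub : @open Y `<=` image_set_system setT f <<s @open X >>.
  move=> A oA; rewrite /image_set_system /= setTI.
  by apply: sub_sigma_algebra; exact: fcont.
by move/(smallest_sub salg sub); rewrite /image_set_system /= setTI.
Qed.

Lemma exists_enumeration : exists e : nat -> points, bijective e.
Proof.
have infT : infinite_set [set: points].
  move=> /(@finite_preimage nat _ _ (fun m => (m, None))) fin.
  by apply: infinite_nat; apply: fin => m n _ _ [].
have /card_set_bijP[f] := eq_card_nat (countableP [set: points]) infT.
by rewrite setTT_bijective => -[e fK eK]; exists e; exists f.
Qed.

Lemma LO_linear (L : LO) : linear_order (LO_rel L).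
Proof. exact: (set_valP L). Qed.

(** * The reduction and its continuity *)

Section Reduction.
Context {e : nat -> points}.
Hypothesis bije : bijective e.

Definition code (L : LO) : prod_topology (fun _ : nat * nat * nat => bool) :=
  fun p => coding (LO_rel L) (e p.1.1) (e p.1.2) (e p.2).

Lemma code_CO (L : LO) : CO (code L).
Proof.
have [rot anti trans tot] := coding_circular (LO_linear L).
rewrite /code; split=> /=.
- by move=> x y z; exact: rot.
- move=> x y z; rewrite anti; have ei := bij_inj bije.
  by split=> [[/ei|/ei|/ei]|[]] ->; [apply: Or31|apply: Or32|apply: Or33
    |apply: Or31|apply: Or32|apply: Or33].
- by move=> x y z xyz t; exact: trans.
- by move=> x y z; exact: tot.
Qed.

Definition reduction (L : LO) : CO := exist _ (code L) (mem_set (code_CO L)).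

Lemma near_LO_rel (L : LO) j k :
  \forall M \near L, LO_rel M j k = LO_rel L j k.
Proof.
have cvgL : LO_rel M j k @[M --> L] --> LO_rel L j k.
  apply: (@continuous_comp _ _ _ (\val : LO -> _) (proj (j, k))).
    exact: initial_continuous.
  exact: proj_continuous.
apply: (cvgL [set LO_rel L j k]).
exact: discrete_set1.
Qed.

Lemma near_sum_order (L : LO) p q :
  \forall M \near L, sum_order (LO_rel M) p q = sum_order (LO_rel L) p q.
Proof.
(* Comparisons with a separator do not consult the linear order, so the default [0] is arbitrary. *)
pose index (v : option (nat * int)) := if v is Some u then u.1 else 0.
apply: filterS (near_LO_rel L (index p.2) (index q.2)) => M.
case: p q => m [[j k]|] [n [[j' k']|]] //=.
by rewrite /sum_order /block_order /lexicographic /= => ->.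
Qed.

(** It suffices to check each coordinate, whose value is determined by three locally constant
    comparisons. *)
Lemma reduction_continuous : continuous reduction.
Proof.
apply: continuous_comp_initial => L.
have ? : Filter (nbhs L) by exact: nbhs_pfilter.
apply/pointwise_cvgP => -[[a b] c].
have near_eq : \forall M \near L, code M (a, b, c) = code L (a, b, c).
  apply: filterS3 (near_sum_order L (e a) (e b)) (near_sum_order L (e b) (e c))
    (near_sum_order L (e c) (e a)) => M ab bc ca.
  by rewrite /code /coding /cyclic_closure /= ab bc ca.
move=> A /nbhs_singleton AL; apply: filterS near_eq => M eqM.
by change (A (code M (a, b, c))); rewrite eqM.
Qed.

Lemma reduction_reduces (L L' : LO) :
  iso_LO L L' <-> bowtie_CO (reduction L) (reduction L').
Proof.
split=> [[g bijg gE]|[emb _]]; last first.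
  apply: coding_recovery (LO_linear L) (LO_linear L') _.
  exact: piecewise_convex_embeddable_transport bije emb.
(* Stated for arbitrary orders so as to apply both to [g] and to its inverse. *)
have iso_embed (M M' : LO) (h : nat -> nat) : bijective h ->
    (forall x y, LO_rel M x y = LO_rel M' (h x) (h y)) ->
  piecewise_convex_embeddable (CO_rel (reduction M)) (CO_rel (reduction M')).
  move=> [h' hK h'K] hE; have codeE := coding_iso (can_inj hK) hE.
  set f := (fun p => _) in codeE; have [d eK dK] := bije.
  apply: (iso_piecewise_convex_embeddable (f := d \o f \o e)) => [||x y z].
  - exact: 0.
  - apply: bij_comp => //; apply: bij_comp; first by exists e.
    exists (fun p => (p.1, omap (fun u => (h' u.1, u.2)) p.2)).
    + by case=> m [[j k]|]; rewrite /f /= ?hK.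
    + by case=> m [[j k]|]; rewrite /f /= ?h'K.
  - by rewrite /CO_rel /= /code /= !dK codeE.
split; first exact: iso_embed bijg gE.
have [g' gK g'K] := bijg.
apply: (iso_embed _ _ g'); first by exists g.
by move=> x y; rewrite gE !g'K.
Qed.

End Reduction.

Theorem theorem3p44 : borel_reducible iso_LO bowtie_CO.
Proof.
have [e bije] := exists_enumeration.
exists (reduction bije); last exact: reduction_reduces.
by apply: continuous_borel; exact: reduction_continuous.
Qed.
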